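(* Let $n\ge1$ and $d=n/2$. Let $a\in(0,\infty)$ and let $F$ be admissible on $I=[0,a)$ with $F\in C^2((0,a))$ and $F'>0$ in $(0,a)$. Set $\kappa_F^*:=\limsup_{r\to\infty}\kappa_F(r)$. (1) Assume that $\kappa_F(r)\le\frac12$ for all $r\in(0,\infty)$ and $\kappa_F^*<\frac12$. Then $U_d[\phi]$ possesses the eventual $F$-concavity property for all $\phi\in\mathcal{L}$ with $M_\phi<a$. (2) Assume that $\kappa_F(r_* )>1/2$ for some $r_*\in(0,\infty)$. Then $U_d[\phi]$ does not possess the eventual $F$-concavity property for some $\phi\in\mathcal{L}$ with $M_\phi<a$.
   Context: $\mathcal{L}$ is the set of nontrivial (not a.e. zero), nonnegative, bounded measurable functions on $\mathbb{R}^n$ with compact support. For $\phi\in\mathcal{L}$, $M_\phi:=\int_{\mathbb{R}^n}\phi(y)\,dy$, $(e^{t\Delta}\phi)(x):=(4\pi t)^{-n/2}\int_{\mathbb{R}^n}e^{-|x-y|^2/(4t)}\phi(y)\,dy$ and $U_d[\phi](x,t):=(4\pi t)^d(e^{t\Delta}\phi)(x)$ for $(x,t)\in\mathbb{R}^n\times(0,\infty)$. (For $d=n/2$, $U_d[\phi]\le M_\phi$.) A function $F:I=[0,a)\to[-\infty,\infty)$ is admissible on $I$ if $F$ is continuous on $(0,a)$, strictly increasing on $I$, and $F(0)=-\infty$. $\mathcal{A}(I)$ is the set of $I$-valued functions on $\mathbb{R}^n$. $f\in\mathcal{A}(I)$ is $F$-concave in $\mathbb{R}^n$ if $F(f((1-\mu)x+\mu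 y))\ge(1-\mu)F(f(x))+\mu F(f(y))$ for all $x,y\in\mathbb{R}^n$, $\mu\in(0,1)$. $U_d[\phi]$ possesses the eventual $F$-concavity property if there exists $T>0$ such that $U_d[\phi](\cdot,t)$ is $F$-concave in $\mathbb{R}^n$ for all $t\in[T,\infty)$. $\mathcal{F}(r):=F(ae^{-r})$ and $\kappa_F(r):=-r\,\mathcal{F}''(r)/\mathcal{F}'(r)$ for $r\in(0,\infty)$. *)

(* Defs.v *)
From HB Require Import structures.
From mathcomp Require Import all_boot all_order all_algebra.
From mathcomp Require Import all_classical all_reals all_analysis.
From mathcomp Require Import measurable_realfun.

Set Implicit Arguments.
Unset Strict Implicit.
Unset Printing Implicit Defensive.

Import Order.TTheory GRing.Theory Num.Theory.
Import numFieldNormedType.Exports.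

Local Open Scope classical_set_scope.
Local Open Scope ring_scope.

(* The Borel sigma-algebra of R^n, generated by the coordinate projections
   (the convention of the library for n.-tuple T). *)
Definition measure_rV_display : measure_display. Proof. exact. Qed.

Section measurable_rV.
Context {R : realType} (n : nat).

Definition coord_rV (i : 'I_n) (x : 'rV[R]_n) : measurableTypeR R := x ord0 i.

Let rV_set0 : g_sigma_preimage coord_rV set0.
Proof. exact: sigma_algebra0. Qed.

Let rV_setC A : g_sigma_preimage coord_rV A -> g_sigma_preimage coord_rV (~` A).
Proof. exact: sigma_algebraC. Qed.

Let rV_bigcup (F : _^nat) : (forall i, g_sigma_preimage coord_rV (F i)) ->
  g_sigma_preimage coord_rV (\bigcup_i (F i)).
Proof. exact: sigma_algebra_bigcup. Qed.

HB.instance Definition _ := @isMeasurable.Build measure_rV_display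
  'rV[R]_n (g_sigma_preimage coord_rV) rV_set0 rV_setC rV_bigcup.

Lemma measurable_coord_rV (i : 'I_n) : measurable_fun setT (coord_rV i).
Proof.
move=> _ Y mY; rewrite setTI; apply: sub_sigma_algebra => /=.
rewrite -bigcup_seq/=; exists i => /=; first by rewrite mem_index_enum.
by exists Y => //; rewrite setTI.
Qed.

Lemma measurable_fun_rV d (T : measurableType d) (f : T -> 'rV[R]_n) :
  (forall i, measurable_fun setT (coord_rV i \o f)) -> measurable_fun setT f.
Proof.
move=> mf; suff S : g_sigma_preimage (fun i => coord_rV i \o f) `<=` measurable.
  move=> _ A mA; apply: S; rewrite g_sigma_preimage_comp.
  by exists A.
apply: smallest_sub; first exact: sigma_algebra_measurable.
rewrite -bigcup_seq; apply: bigcup_sub => i _.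
by move=> A [B mB <-]; exact: mf.
Qed.

End measurable_rV.

Section lebesgue_rV.
Context {R : realType}.

Definition cons_rV n (p : measurableTypeR R * 'rV[R]_n) : 'rV[R]_n.+1 :=
  row_mx (p.1%:M : 'rV_1) p.2.

Lemma cons_rV0 n p : @cons_rV n p ord0 ord0 = p.1.
Proof.
rewrite /cons_rV mxE; case: splitP => [j _|j //].
by rewrite !mxE !ord1 eqxx mulr1n.
Qed.

Lemma cons_rVS n p i : @cons_rV n p ord0 (lift ord0 i) = p.2 ord0 i.
Proof.
rewrite /cons_rV mxE; case: splitP => [[[|//] ?] //|j /= ij].
by congr (p.2 _ _); apply: val_inj; case: ij.
Qed.

Definition tail_rV n (x : 'rV[R]_n.+1) : 'rV[R]_n :=
  \row_i x ord0 (lift ord0 i).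

Lemma cons_rVK n (p : measurableTypeR R * 'rV[R]_n) :
  (coord_rV ord0 (cons_rV p), tail_rV (cons_rV p)) = p.
Proof.
case: p => x v; rewrite /coord_rV cons_rV0; congr pair.
by apply/rowP => i; rewrite mxE cons_rVS.
Qed.

Lemma measurable_cons_rV n : measurable_fun setT (@cons_rV n).
Proof.
apply: measurable_fun_rV => i; case: (unliftP ord0 i) => [j|] ->.
  rewrite (_ : _ \o _ = coord_rV j \o snd); last first.
    by apply/funext => p /=; rewrite /coord_rV cons_rVS.
  exact: measurableT_comp (measurable_coord_rV j) measurable_snd.
rewrite (_ : _ \o _ = fst); first exact: measurable_fst.
by apply/funext => p /=; rewrite /coord_rV cons_rV0.
Qed.

Lemma measurable_tail_rV n : measurable_fun setT (@tail_rV n).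
Proof.
apply: measurable_fun_rV => i.
rewrite (_ : _ \o _ = coord_rV (lift ord0 i)); first exact: measurable_coord_rV.
by apply/funext => p /=; rewrite /coord_rV mxE.
Qed.

Section step.
Context n (m : {sigma_finite_measure set 'rV[R]_n -> \bar R}).

Definition lebesgue_rV_step : set 'rV[R]_n.+1 -> \bar R :=
  pushforward (lebesgue_measure \x m)%E (@cons_rV n).

Let step0 : lebesgue_rV_step set0 = 0%E.
Proof. by rewrite /lebesgue_rV_step /pushforward preimage_set0 measure0. Qed.

Let step_ge0 A : (0 <= lebesgue_rV_step A)%E.
Proof. by rewrite /lebesgue_rV_step /pushforward; exact: measure_ge0. Qed.

Let step_sigma_additive : semi_sigma_additive lebesgue_rV_step.
Proof.
move=> F mF tF mUF; rewrite /lebesgue_rV_step /pushforward preimage_bigcup.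
have mc (A : set 'rV[R]_n.+1) : measurable A -> measurable (@cons_rV n @^-1` A).
  by move=> mA; rewrite -[X in measurable X]setTI; exact: measurable_cons_rV.
apply: measure_semi_sigma_additive.
- by move=> k; exact: mc.
- apply/trivIsetP => /= i j _ _ ij; rewrite -preimage_setI.
  by move/trivIsetP : tF => /(_ _ _ _ _ ij) ->//; rewrite preimage_set0.
- by rewrite -preimage_bigcup; exact: mc.
Qed.

HB.instance Definition _ := isMeasure.Build _ _ _ lebesgue_rV_step
  step0 step_ge0 step_sigma_additive.

Let step_sigma_finite : sigma_finite setT lebesgue_rV_step.
Proof.
have /sigma_finiteP[F [FT ndF Foo]] := sigma_finiteT (@lebesgue_measure R).
have /sigma_finiteP[G [GT ndG Goo]] := sigma_finiteT m.
pose h (x : 'rV[R]_n.+1) := (coord_rV ord0 x, tail_rV x).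
have mh : measurable_fun setT h.
  apply/measurable_fun_pair; first exact: measurable_coord_rV.
  exact: measurable_tail_rV.
exists (fun k => h @^-1` (F k `*` G k)).
  apply/esym/seteqP; split => // x _.
  have [i _ Fi] : (\bigcup_i F i) (coord_rV ord0 x) by rewrite -FT.
  have [j _ Gj] : (\bigcup_i G i) (tail_rV x) by rewrite -GT.
  exists (maxn i j) => //; split => /=.
  - by move: Fi; exact/subsetPset/ndF/leq_maxl.
  - by move: Gj; exact/subsetPset/ndG/leq_maxr.
move=> k; have [mFk Fkoo] := Foo k; have [mGk Gkoo] := Goo k; split.
  by rewrite -[X in measurable X]setTI; apply: mh => //; exact: measurableX.
rewrite /lebesgue_rV_step /pushforward -comp_preimage.
rewrite (_ : h \o _ = id); last by apply/funext => p; exact: cons_rVK.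
by rewrite preimage_id product_measure1E// lte_mul_pinfty// ge0_fin_numE.
Qed.

HB.instance Definition _ := Measure_isSigmaFinite.Build _ _ _ lebesgue_rV_step
  step_sigma_finite.

End step.

(* Lebesgue measure on R^n; see lebesgue_rV_box for its value on boxes. *)
Fixpoint lebesgue_rV n : {sigma_finite_measure set 'rV[R]_n -> \bar R} :=
  match n with
  | 0 => [the {sigma_finite_measure set 'rV[R]_0 -> \bar R} of
         dirac (0 : 'rV[R]_0)]
  | k.+1 => [the {sigma_finite_measure set 'rV[R]_k.+1 -> \bar R} of
             lebesgue_rV_step (lebesgue_rV k)]
  end.

Lemma lebesgue_rV_box n (A : 'I_n -> set (measurableTypeR R)) :
  (forall i, measurable (A i)) ->
  lebesgue_rV n [set x | forall i, A i (x ord0 i)] =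
  (\prod_(i < n) lebesgue_measure (A i))%E.
Proof.
elim: n A => [|n IH] A mA.
  rewrite big_ord0 /= diracE mem_set//=; by case.
rewrite big_ord_recl -IH//.
have mB : measurable [set x : 'rV[R]_n | forall i, A (lift ord0 i) (x ord0 i)].
  rewrite (_ : [set x | _] = \big[setI/setT]_(i < n)
      (coord_rV i @^-1` A (lift ord0 i))); last first.
    rewrite -bigcap_seq; apply/seteqP; split => x /= h i; first by move=> _; exact: h.
    by apply: h; rewrite /= mem_index_enum.
  apply: bigsetI_measurable => i _.
  by rewrite -[X in measurable X]setTI; exact: measurable_coord_rV.
rewrite -product_measure1E// [LHS]/= /lebesgue_rV_step /pushforward.
congr product_measure1; apply/seteqP; split => -[x v] /=.
  move=> h; split=> [|i]; first by have := h ord0; rewrite cons_rV0.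
  by have := h (lift ord0 i); rewrite cons_rVS.
move=> [h0 h] i; case: (unliftP ord0 i) => [j|] ->; first by rewrite cons_rVS.
by rewrite cons_rV0.
Qed.

End lebesgue_rV.

(* Measurability in the sense of Lebesgue, i.e., for the completion of the
   Borel sigma-algebra (measurable_fun is Borel measurability). The library
   integral of a nonnegative function is a supremum over Borel simple functions,
   and agrees with the Lebesgue integral on this larger class. *)
Definition lebesgue_measurable_fun (R : realType) n (phi : 'rV[R]_n -> R) :=
  forall B : set (measurableTypeR R), measurable B ->
    completed_algebra_gen (lebesgue_rV n) (phi @^-1` B).

Definition classL (R : realType) n : set ('rV[R]_n -> R) :=
  [set phi | [/\ lebesgue_measurable_fun phi,
                 ~ {ae lebesgue_rV n, forall x, phi x = 0},
                 forall x, 0 <= phi x,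
                 exists C, forall x, phi x <= C &
                 compact (closure [set x | phi x != 0])]].

Definition mass (R : realType) n (phi : 'rV[R]_n -> R) : R :=
  \int[lebesgue_rV n]_(y in setT) phi y.

(* The library norm on 'rV[R]_n is the sup norm. *)
Definition sqnorm (R : realType) n (x : 'rV[R]_n) : R :=
  \sum_(i < n) x ord0 i ^+ 2.

Definition heat (R : realType) n (phi : 'rV[R]_n -> R) (t : R) (x : 'rV[R]_n) : R :=
  (4 * pi * t) `^ (- (n%:R / 2)) *
  \int[lebesgue_rV n]_(y in setT) (expR (- (sqnorm (x - y) / (4 * t))) * phi y).

Definition U (R : realType) n (d : R) (phi : 'rV[R]_n -> R)
    (x : 'rV[R]_n) (t : R) : R :=
  (4 * pi * t) `^ d * heat phi t x.

(* A function F : [0, a) -> [-oo, +oo) is represented by a total function of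
   type R -> \bar R, of which only the values on [0, a) are used. *)
Definition admissible (R : realType) (a : R) (F : R -> \bar R) :=
  [/\ forall s, 0 <= s < a -> (F s < +oo)%E,
      forall s, 0 < s < a -> {for s, continuous F},
      forall s1 s2, 0 <= s1 -> s1 < s2 -> s2 < a -> (F s1 < F s2)%E &
      F 0 = -oo%E].

(* The first clause says that f is [0, a)-valued. As F is never +oo on [0, a),
   the sum on the left-hand side never involves +oo. *)
Definition F_concave (R : realType) n (a : R) (F : R -> \bar R)
    (f : 'rV[R]_n -> R) :=
  (forall x, 0 <= f x < a) /\
  forall (x y : 'rV[R]_n) (mu : R), 0 < mu < 1 ->
    ((1 - mu)%:E * F (f x) + mu%:E * F (f y)
      <= F (f ((1 - mu) *: x + mu *: y)%R))%E.

Definition eventually_F_concave (R : realType) n (a : R) (F : R -> \bar R)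
    (d : R) (phi : 'rV[R]_n -> R) :=
  exists2 T : R, 0 < T &
    forall t, T <= t -> F_concave a F (fun x => U d phi x t).

Definition C2_on (R : realType) (a : R) (f : R -> R) :=
  forall s, 0 < s < a ->
    [/\ derivable f s 1, derivable (derive1 f) s 1 &
        {for s, continuous (derive1 (derive1 f))}].

Definition calF (R : realType) (a : R) (F : R -> \bar R) (r : R) : R :=
  fine (F (a * expR (- r))).

Definition kappa (R : realType) (a : R) (F : R -> \bar R) (r : R) : R :=
  - r * derive1 (derive1 (calF a F)) r / derive1 (calF a F) r.

Definition kappa_star (R : realType) (a : R) (F : R -> \bar R) : \bar R :=
  limf_esup (fun r => (kappa a F r)%:E) (pinfty_nbhs R).

(* Main.v *)
Require Import Defs.
From mathcomp Require Import all_boot all_order all_algebra.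
From mathcomp Require Import all_classical all_reals all_analysis.
From mathcomp Require Import measurable_realfun ring lra.

(* For d = n/2 the function u = U_d[phi](., t) is the convolution of phi with
   exp(- |x|^2 / (4t)). Put rho = - ln (u / a) > 0; then F(u) = calF(rho), and
   since calF' < 0, F(u) is concave iff
     kappa(rho) (d_v rho)^2 <= rho d_v^2 rho
   in every direction v.

   (1) Up to |x|^2 / (4t), rho is minus the logarithm of a Laplace transform of
   a compactly supported weight. If phi lives in the ball of radius S, this gives
   |d_v rho| <= |v| (|x| + S) / (2t), d_v^2 rho >= |v|^2 (1 - S^2/(2t)) / (2t) and
   rho >= q^2 - 2 q e + delta, where q = |x| / (2 sqrt t), e = S / (2 sqrt t) and
   delta = ln (a / M_phi) > 0. For bounded q the inequality with 1/2 in place of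
   kappa holds for small e thanks to delta; for large q, rho is large and kappa
   is bounded away from 1/2.

   (2) For phi a multiple of the indicator of the unit cube with mass
   a exp(- delta), u(2 sqrt t s e, t) tends to a exp(- delta - s^2), so eventual
   F-concavity makes s |-> calF(delta + s^2) concave, that is
   2 kappa(r) (r - delta) <= r for all r > delta; this is false at r = r_* when
   delta is small. *)

Import Order.TTheory GRing.Theory Num.Theory.
Import numFieldNormedType.Exports.

Local Open Scope classical_set_scope.
Local Open Scope ring_scope.

(** * Integration against a Lebesgue measurable density *)

Section completion.
Context d (T : measurableType d) (R : realType).
Variable mu : {measure set T -> \bar R}.

(** Up to null sets, the superlevel sets of [f] at rational heights are Borel. The union [N] of
    these countably many null sets is null, and off [N] every superlevel set is a countable union of
    Borel ones. *)
Lemma completed_measurable_restrict (f : T -> R) :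
  (forall B : set (measurableTypeR R), measurable B ->
    completed_algebra_gen mu (f @^-1` B)) ->
  exists N, [/\ measurable N, mu N = 0%E &
    measurable_fun setT (f \_ (~` N) : T -> measurableTypeR R)].
Proof.
move=> mf.
(* [q] enumerates the rationals; a code that decodes to nothing gives the harmless value 0. *)
pose q (k : nat) : R := ratr (odflt 0 (unpickle k)).
have /choice[AN ANP] k : exists AN : set T * set T,
    [/\ measurable AN.1, measurable AN.2, mu AN.2 = 0%E,
     AN.1 `<=` f @^-1` `]q k, +oo[ & f @^-1` `]q k, +oo[ `<=` AN.1 `|` AN.2].
  have [A mA [N [M [mM M0 NM]] ANE]] := mf _ (measurable_itv `]q k, +oo[).
  exists (A, M); split => //=; first by rewrite -ANE; exact: subsetUl.
  by rewrite -ANE; exact: setUS.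
pose N := \bigcup_k (AN k).2.
have mN : measurable N by apply: bigcup_measurable => k _; have [] := ANP k.
exists N; split => //.
  apply/negligibleP => //; apply: negligible_bigcup => k.
  by apply/negligibleP; have [] := ANP k.
apply: (measurability _ (RGenOInfty.measurableE R)) => // _ [_ [c ->] <-].
rewrite setTI.
(* The restricted function is 0 on [N], so [N] lies in the superlevel set exactly when [c < 0]. *)
have -> : (f \_ (~` N)) @^-1` `]c, +oo[ =
    (\bigcup_k (if c < q k then (AN k).1 else set0) `\` N)
    `|` (if c < 0 then N else set0).
  apply/seteqP; split=> x /=; rewrite in_itv/= andbT patchE.
    case: ifPn => [|]; rewrite ?(inE, notin_setE)/= => Nx.
      move=> cfx; left.
      have [r] := rat_in_itvoo cfx; rewrite in_itv/= => /andP[cr rf].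
      have qr : q (pickle r) = ratr r by rewrite /q pickleK.
      split => //; exists (pickle r) => //; rewrite qr cr.
      have [_ _ _ _ /(_ x)] := ANP (pickle r).
      rewrite /= in_itv/= qr rf => /(_ isT)[//|Mx].
      by exfalso; apply: Nx; exists (pickle r).
    by move=> c0; right; rewrite c0; apply: contrapT.
  move=> [[[k _]]|].
    case: ifPn => [cq Ak Nx|_ []//].
    rewrite mem_set//=; have [_ _ _ /(_ _ Ak) + _] := ANP k.
    by rewrite /= in_itv/= andbT; exact: lt_trans.
  by case: ifPn => // c0 Nx; rewrite memNset.
apply: measurableU; last by case: ifPn.
apply: measurableD => //; apply: bigcup_measurable => k _.
by case: ifPn => // _; have [] := ANP k.
Qed.

Import HBNNSimple.

(* No measurability is assumed: the integral of a nonnegative function is a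
   supremum over simple functions, which can be cut off on [N]. *)
Lemma ge0_le_integral_null (f g : T -> \bar R) (N : set T) :
  measurable N -> mu N = 0%E -> (forall x, 0 <= f x)%E ->
  (forall x, 0 <= g x)%E -> (forall x, ~ N x -> f x <= g x)%E ->
  (\int[mu]_x f x <= \int[mu]_x g x)%E.
Proof.
move=> mN N0 f0 g0 fg; rewrite (ge0_integralTE _ f0) (ge0_integralTE _ g0).
apply: ge_ereal_sup => _ [h /= hf <-].
have mCN := measurableC mN.
have -> : sintegral mu h = sintegral mu (proj_nnsfun h mCN).
  rewrite -!integralT_nnsfun; apply: ge0_ae_eq_integral => //.
  - exact/measurable_EFinP.
  - exact/measurable_EFinP.
  - by move=> x _; rewrite lee_fin.
  - by move=> x _; rewrite lee_fin.
  exists N; split => // x /= /not_implyP[_]; apply: contra_notP => Nx.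
  by rewrite mindicE mem_set// mulr1.
apply: ereal_sup_ubound; exists (proj_nnsfun h mCN) => //= x.
rewrite mindicE; have [|Nx] := boolP (x \in ~` N).
  by rewrite inE mulr1 => Nx; exact: le_trans (hf x) (fg x Nx).
by rewrite mulr0.
Qed.

Lemma ge0_eq_Rintegral_null (f g : T -> R) (N : set T) :
  measurable N -> mu N = 0%E -> (forall x, 0 <= f x) ->
  (forall x, 0 <= g x) -> (forall x, ~ N x -> f x = g x) ->
  \int[mu]_x f x = \int[mu]_x g x.
Proof.
move=> mN N0 f0 g0 fg; rewrite /Rintegral; congr fine.
by apply/eqP; rewrite eq_le; apply/andP; split;
  apply: (ge0_le_integral_null _ _ N) => // x Nx; rewrite ?lee_fin ?fg.
Qed.

End completion.

(** * Integrals with a bounded factor; Laplace transforms *)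

Section weighted.
Context d (T : measurableType d) (R : realType).
Variables (mu : {measure set T -> \bar R}) (phi : T -> R).
Hypotheses (phi_ge0 : forall y, 0 <= phi y)
  (iphi : mu.-integrable setT (EFin \o phi)).

Let mphi : measurable_fun setT phi.
Proof. by have /integrableP[/measurable_EFinP] := iphi. Qed.

(** The bound is asked only where [phi] is nonzero, so that exponentials of linear functions qualify
    when [phi] has bounded support. *)
Lemma integrable_weighted (g : T -> R) (C : R) : measurable_fun setT g ->
  (forall y, phi y != 0 -> `|g y| <= C) ->
  mu.-integrable setT (EFin \o (fun y => g y * phi y)).
Proof.
move=> mg gC; apply: le_integrable (integrableZl measurableT C iphi) => //.
  exact/measurable_EFinP/measurable_funM.
move=> y _; rewrite lee_fin !normrM; have [->|y0] := eqVneq (phi y) 0.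
  by rewrite normr0 !mulr0.
by rewrite ler_wpM2r// (le_trans (gC _ y0))// ler_norm.
Qed.

Lemma le_weighted (g h : T -> R) (C : R) :
  measurable_fun setT g -> measurable_fun setT h ->
  (forall y, phi y != 0 -> `|g y| <= C) ->
  (forall y, phi y != 0 -> `|h y| <= C) ->
  (forall y, phi y != 0 -> g y <= h y) ->
  \int[mu]_y (g y * phi y) <= \int[mu]_y (h y * phi y).
Proof.
move=> mg mh gC hC gh; apply: le_Rintegral => //.
- exact: integrable_weighted gC.
- exact: integrable_weighted hC.
move=> y _; have [->|y0] := eqVneq (phi y) 0; first by rewrite !mulr0.
by rewrite ler_wpM2r// gh.
Qed.

Lemma weighted_le (g : T -> R) (m : R) : measurable_fun setT g ->
  (forall y, phi y != 0 -> 0 <= g y <= m) ->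
  \int[mu]_y (g y * phi y) <= m * \int[mu]_y phi y.
Proof.
move=> mg gm; rewrite -RintegralZl//.
apply: (le_weighted _ (cst m) m) => //.
- by move=> y y0; have /andP[g0 ?] := gm _ y0; rewrite ger0_norm.
- move=> y y0; have /andP[g0 ?] := gm _ y0.
  by rewrite ger0_norm// (le_trans g0).
- by move=> y y0; have /andP[] := gm _ y0.
Qed.

Lemma weighted_ge (g : T -> R) (m C : R) : measurable_fun setT g -> 0 <= m ->
  (forall y, phi y != 0 -> m <= g y <= C) ->
  m * \int[mu]_y phi y <= \int[mu]_y (g y * phi y).
Proof.
move=> mg m0 gm; rewrite -RintegralZl//.
apply: (le_weighted (cst m) _ C) => //.
- move=> y y0; have /andP[? ?] := gm _ y0.
  by rewrite ger0_norm// (@le_trans _ _ (g y)).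
- move=> y y0; have /andP[mg0 ?] := gm _ y0.
  by rewrite ger0_norm// (le_trans m0).
- by move=> y y0; have /andP[] := gm _ y0.
Qed.

Section laplace.
Variables (w : T -> R) (B : R).
Hypotheses (mw : measurable_fun setT w)
  (wB : forall y, phi y != 0 -> `|w y| <= B).

(** Unnormalised moments of [w] under the measure [phi mu] tilted by [exp(s w)]: the Laplace
    transform for [k = 0], its successive derivatives for larger [k]. *)
Definition laplace_moment (k : nat) (s : R) : R :=
  \int[mu]_y (w y ^+ k * expR (s * w y) * phi y).

Let measurable_moment k s :
  measurable_fun setT (fun y => w y ^+ k * expR (s * w y)).
Proof.
apply: measurable_funM; first exact: measurable_funX.
by apply: measurableT_comp => //; exact: measurable_funM.
Qed.

Let moment_bound k (s u : R) y : phi y != 0 -> `|s| <= u ->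
  `|w y ^+ k * expR (s * w y)| <= B ^+ k * expR (u * B).
Proof.
move=> y0 su; have wy := wB _ y0.
rewrite normrM normrX (ger0_norm (expR_ge0 _)) ler_pM//.
  by rewrite lerXn2r// nnegrE (le_trans _ wy).
rewrite ler_expR (le_trans (ler_norm _))// normrM ler_pM//.
Qed.

(** Differentiation under the integral sign: for parameters within distance 1 of [s], the
    differentiated integrand is dominated by a constant times [phi], because [w] is bounded by [B]
    where [phi] is nonzero. *)
Lemma is_derive_laplace_moment (k : nat) (s : R) :
  is_derive s 1 (laplace_moment k) (laplace_moment k.+1 s).
Proof.
pose f s y := w y ^+ k * expR (s * w y) * phi y.
have df (t : R) y : is_derive t 1 (f ^~ y) (w y ^+ k.+1 * expR (t * w y) * phi y).
  by rewrite /f; apply: is_derive_eq; rewrite /GRing.scale/= exprS; ring.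
have Df (t : R) y : partial1of2 f t y = w y ^+ k.+1 * expR (t * w y) * phi y.
  by rewrite partial1of2E derive_val.
have := @cvg_differentiation_under_integral R _ T mu f setT measurableT s
  (s - 1) (s + 1).
have sI : s \in `](s - 1), (s + 1)[ by rewrite in_itv/=; lra.
move=> /(_ sI) cvgE.
have su (t : R) : t \in `](s - 1), (s + 1)[ -> `|t| <= `|s| + 1.
  rewrite in_itv/= => /andP[t1 t2].
  have := ler_norm s; have := ler_norm (- s); rewrite normrN => s1 s2.
  by rewrite ler_norml; lra.
pose C := B ^+ k.+1 * expR ((`|s| + 1) * B).
(* The absolute value keeps the dominating function nonnegative: [B] could be negative if [phi] is
   identically 0. *)
have {cvgE} := cvgE _ _ (fun y => `|C| * phi y).
have -> : \int[mu]_y partial1of2 f s y = laplace_moment k.+1 s.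
  by apply: eq_Rintegral => y _; rewrite Df.
move=> cvgE.
have {}cvgE : h^-1 *: (laplace_moment k (h + s) - laplace_moment k s)
    @[h --> 0^'] --> laplace_moment k.+1 s.
  apply: cvgE.
  - by move=> t _; apply: (integrable_weighted _ (B ^+ k * expR (`|t| * B))) => //
      y y0; exact: moment_bound.
  - by move=> t y _ _; exact: ex_derive.
  - by move=> y; rewrite mulr_ge0.
  - by have := integrableZl measurableT `|C| iphi.
  - move=> t y /su tu _; rewrite Df; have [->|y0] := eqVneq (phi y) 0.
      by rewrite !mulr0 normr0.
    rewrite normrM (ger0_norm (phi_ge0 y)) ler_wpM2r//.
    by rewrite (le_trans (moment_bound _ _ _ _ y0 tu))// ler_norm.
apply: DeriveDef.
  apply/cvg_ex; exists (laplace_moment k.+1 s).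
  by under eq_fun do rewrite scaler1.
apply: cvg_lim; first exact: norm_hausdorff.
by under eq_fun do rewrite scaler1.
Qed.

(** The mean of [w] under the tilted measure is at most [B] in absolute value; multiplying out
    avoids dividing by the total mass. *)
Lemma laplace_moment1_le (s : R) : `|laplace_moment 1 s| <= B * laplace_moment 0 s.
Proof.
have i k : mu.-integrable setT (EFin \o
    (fun y => w y ^+ k * expR (s * w y) * phi y)).
  by apply: (integrable_weighted _ (B ^+ k * expR (`|s| * B))) => // y y0;
    exact: moment_bound.
rewrite (le_trans (le_normr_Rintegral _ (i 1%N)))//.
rewrite -RintegralZl//; apply: le_Rintegral => //.
- by have := integrable_norm (i 1%N).
- by have := integrableZl measurableT B (i 0%N).
move=> y _; have [->|y0] := eqVneq (phi y) 0; first by rewrite !mulr0 normr0.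
rewrite !normrM expr0 expr1 mul1r (ger0_norm (phi_ge0 y)).
rewrite (ger0_norm (expR_ge0 _)) mulrA.
by rewrite ler_wpM2r// ler_wpM2r ?expR_ge0// wB.
Qed.

Lemma laplace_moment2_le (s : R) :
  laplace_moment 2 s <= B ^+ 2 * laplace_moment 0 s.
Proof.
have i k : mu.-integrable setT (EFin \o
    (fun y => w y ^+ k * expR (s * w y) * phi y)).
  by apply: (integrable_weighted _ (B ^+ k * expR (`|s| * B))) => // y y0;
    exact: moment_bound.
rewrite -RintegralZl//; apply: le_Rintegral => //.
  by have := integrableZl measurableT (B ^+ 2) (i 0%N).
move=> y _; have [->|y0] := eqVneq (phi y) 0; first by rewrite !mulr0.
rewrite expr0 mul1r mulrA ler_wpM2r// ler_wpM2r ?expR_ge0//.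
by rewrite -real_normK ?num_real// lerXn2r ?nnegrE ?wB// (le_trans _ (wB _ y0)).
Qed.

End laplace.
End weighted.

(** * Euclidean geometry and Lebesgue measure on R^n *)

Section euclidean.
Context {R : realType} {n : nat}.
Implicit Types x y v : 'rV[R]_n.

Definition dot_rV x y : R := \sum_(i < n) x ord0 i * y ord0 i.

Lemma sqnorm_ge0 x : 0 <= sqnorm x.
Proof. by apply: sumr_ge0 => i _; exact: sqr_ge0. Qed.

Lemma sqnorm_line x v (s : R) :
  sqnorm (x + s *: v) = sqnorm x + 2 * s * dot_rV x v + s ^+ 2 * sqnorm v.
Proof.
rewrite /sqnorm /dot_rV !mulr_sumr -!big_split; apply: eq_bigr => i _ /=.
by rewrite !mxE; ring.
Qed.

Lemma sqnormB x y : sqnorm (x - y) = sqnorm x - 2 * dot_rV x y + sqnorm y.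
Proof. by rewrite -scaleN1r sqnorm_line; ring. Qed.

Lemma dot_rV_line x v y (s : R) :
  dot_rV (x + s *: v) y = dot_rV x y + s * dot_rV v y.
Proof.
rewrite /dot_rV mulr_sumr -big_split; apply: eq_bigr => i _ /=.
by rewrite !mxE; ring.
Qed.

Lemma dot_rV_cauchy_schwarz x y : dot_rV x y ^+ 2 <= sqnorm x * sqnorm y.
Proof.
have [x0|x0] := eqVneq (sqnorm x) 0.
  have xi i : x ord0 i = 0.
    move/eqP: x0; rewrite psumr_eq0 => [|j _]; last exact: sqr_ge0.
    by move=> /allP /(_ i); rewrite mem_index_enum sqrf_eq0 => /(_ isT)/eqP.
  rewrite x0 mul0r /dot_rV big1 ?expr0n// => i _.
  by rewrite xi mul0r.
have xgt0 : 0 < sqnorm x by rewrite lt_neqAle eq_sym x0 sqnorm_ge0.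
(* The component of [y] orthogonal to [x] has nonnegative squared length. *)
have := sqnorm_ge0 (y + (- (dot_rV x y / sqnorm x)) *: x).
rewrite sqnorm_line.
have -> : dot_rV y x = dot_rV x y.
  by apply: eq_bigr => i _; rewrite mulrC.
rewrite -(pmulr_rge0 _ xgt0) => h; rewrite -subr_ge0; apply: le_trans h _.
by rewrite le_eqVlt; apply/orP; left; apply/eqP; field.
Qed.

Lemma dot_rV_le x y (P S : R) : 0 <= P -> 0 <= S -> sqnorm x <= P ^+ 2 ->
  sqnorm y <= S ^+ 2 -> `|dot_rV x y| <= P * S.
Proof.
move=> P0 S0 xP yS; rewrite -(@ler_pXn2r _ 2)// ?nnegrE ?mulr_ge0//.
rewrite real_normK ?num_real// (le_trans (dot_rV_cauchy_schwarz _ _))//.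
by rewrite exprMn ler_pM// sqnorm_ge0.
Qed.

Lemma measurable_dot_rV v : measurable_fun setT (dot_rV v).
Proof.
apply: measurable_sum => i; apply: measurable_funM => //.
exact: (measurable_coord_rV i).
Qed.

Lemma measurable_sqnorm : measurable_fun setT (@sqnorm R n).
Proof.
apply: measurable_sum => i; apply: measurable_funX.
exact: (measurable_coord_rV i).
Qed.

Lemma measurable_sqnormB x : measurable_fun setT (fun y => sqnorm (x - y)).
Proof.
under eq_fun do rewrite sqnormB.
apply: measurable_funD; last exact: measurable_sqnorm.
apply: measurable_funB => //; apply: measurable_funM => //.
exact: measurable_dot_rV.
Qed.

Lemma measurable_gauss x (t : R) :
  measurable_fun setT (fun y => expR (- (sqnorm (x - y) / (4 * t)))).
Proof.
apply: measurableT_comp => //; apply: measurable_funN.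
by apply: measurable_funM => //; exact: measurable_sqnormB.
Qed.

Definition cube_rV (b c : R) : set 'rV[R]_n :=
  [set x | forall i, `[b, c]%classic (x ord0 i)].

Lemma measurable_cube_rV (b c : R) : measurable (cube_rV b c).
Proof.
rewrite (_ : cube_rV b c = \big[setI/setT]_(i < n) (coord_rV i @^-1` `[b, c])).
  apply: bigsetI_measurable => i _.
  by rewrite -[X in measurable X]setTI; exact: measurable_coord_rV.
rewrite -bigcap_seq; apply/seteqP; split => x /= h i; first by move=> _; exact: h.
by apply: h; rewrite /= mem_index_enum.
Qed.

Lemma lebesgue_cube_rV (b c : R) : b <= c ->
  lebesgue_rV n (cube_rV b c) = ((c - b) ^+ n)%:E.
Proof.
move=> bc.
rewrite (lebesgue_rV_box (A := fun=> `[b, c]%classic : set (measurableTypeR R)))//.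
under eq_bigr do rewrite lebesgue_measure_itv/= lte_fin.
rewrite (eq_bigr (fun=> (c - b)%:E)); last first.
  move=> i _; move: bc; rewrite le_eqVlt => /predU1P[->|->]//.
  by rewrite ltxx subrr.
by rewrite prodEFin prodr_const card_ord.
Qed.

Lemma integrable_cube_rV (b c M : R) (f : 'rV[R]_n -> R) :
  measurable_fun setT f -> (forall y, 0 <= f y <= M) ->
  (forall y, f y != 0 -> cube_rV b c y) -> b <= c ->
  (lebesgue_rV n).-integrable setT (EFin \o f).
Proof.
move=> mf fM fK bc; apply/integrableP; split; first exact/measurable_EFinP.
apply: (@le_lt_trans _ _ (\int[lebesgue_rV n]_y (M * \1_(cube_rV b c) y)%:E)%E).
  apply: ge0_le_integral => //.
  - exact/measurable_EFinP/measurableT_comp.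
  - apply/measurable_EFinP/measurable_funM => //.
    by apply: measurable_indic; exact: measurable_cube_rV.
  move=> y _; have /andP[f0 fleM] := fM y; rewrite lee_fin ger0_norm// indicE.
  have [yK|yK] := boolP (y \in cube_rV b c); first by rewrite mulr1.
  rewrite mulr0; have [->//|fy] := eqVneq (f y) 0.
  by move: yK; rewrite notin_setE => /(_ (fK _ fy)).
under eq_integral do rewrite EFinM.
have M0 : 0 <= M by have /andP[] := fM 0; exact: le_trans.
have mK : measurable_fun setT
    (fun y : 'rV[R]_n => (\1_(cube_rV b c) y)%:E : \bar R).
  by apply/measurable_EFinP; apply: measurable_indic; exact: measurable_cube_rV.
rewrite (ge0_integralZl _ _ mK)//.
rewrite integral_indic//; last exact: measurable_cube_rV.
by rewrite setIT [X in (_ * X)%E](lebesgue_cube_rV _ _ bc) -EFinM ltry.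
Qed.

End euclidean.

(** * Reduction of the initial data to Borel data *)

Section classL.
Context {R : realType} {n : nat}.

(** For [d = n/2] the prefactor cancels the normalisation of the heat kernel. *)
Lemma U_half (phi : 'rV[R]_n -> R) (x : 'rV[R]_n) (t : R) : 0 < t ->
  U (n%:R / 2) phi x t =
  \int[lebesgue_rV n]_y (expR (- (sqnorm (x - y) / (4 * t))) * phi y).
Proof.
move=> t0; rewrite /U /heat powRN mulrA divff ?mul1r//.
by rewrite gt_eqF// powR_gt0// !mulr_gt0// pi_gt0.
Qed.

Lemma bounded_cube_rV (A : set 'rV[R]_n) :
  bounded_set A -> exists2 b : R, 0 <= b & A `<=` cube_rV (- b) b.
Proof.
move=> [M [_ MA]]; exists (`|M| + 1); first by rewrite addr_ge0.
move=> x Ax i; have M1 : M < `|M| + 1.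
  by rewrite (le_lt_trans (ler_norm _))// ltrDl.
have := MA _ M1 x Ax => /= xM; rewrite in_itv/= -ler_norml.
apply: le_trans xM; rewrite /Num.norm/= mx_normrE.
exact: (le_bigmax _ (fun ij : 'I_1 * 'I_n => `|x ij.1 ij.2|) (ord0, i)).
Qed.

(** [phi] is replaced by the Borel function [psi] that agrees with it off a null set: mass and
    solution are unchanged, and the integration lemmas, which need measurability, apply to [psi]. *)
Lemma classL_borel (phi : 'rV[R]_n -> R) : classL phi ->
  exists psi : 'rV[R]_n -> R,
  [/\ forall y, 0 <= psi y,
      (lebesgue_rV n).-integrable setT (EFin \o psi),
      0 < \int[lebesgue_rV n]_y psi y,
      mass phi = \int[lebesgue_rV n]_y psi y &
      (exists2 S : R, 0 <= S & forall y, psi y != 0 -> sqnorm y <= S ^+ 2) /\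
      forall x t, 0 < t -> U (n%:R / 2) phi x t =
        \int[lebesgue_rV n]_y (expR (- (sqnorm (x - y) / (4 * t))) * psi y)].
Proof.
move=> [mphi phin0 phi0 [C phiC] /compact_bounded/bounded_cube_rV[b b0 bK]].
have [N [mN N0 mpsi]] := completed_measurable_restrict _ _ _ (lebesgue_rV n) phi mphi.
set psi := phi \_ (~` N) in mpsi.
have psiE y : ~ N y -> phi y = psi y by move=> Ny; rewrite /psi patchE mem_set.
have psi_cases y : psi y = phi y \/ psi y = 0.
  by rewrite /psi patchE; case: ifP; [left|right].
have psi0 y : 0 <= psi y by case: (psi_cases y) => ->.
have psiK y : psi y != 0 -> cube_rV (- b) b y.
  move=> yn0; apply: bK; apply: subset_closure => /=.
  by case: (psi_cases y) yn0 => [->//|->]; rewrite eqxx.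
have C0 : 0 <= C by apply: le_trans (phiC 0).
have ipsi : (lebesgue_rV n).-integrable setT (EFin \o psi).
  apply: (integrable_cube_rV (- b) b C) => //; last lra.
  by move=> y; rewrite psi0/=; case: (psi_cases y) => ->.
have intE g : (forall y, 0 <= g y) ->
    \int[lebesgue_rV n]_y (g y * phi y) = \int[lebesgue_rV n]_y (g y * psi y).
  move=> g0; apply: (ge0_eq_Rintegral_null _ _ _ _ _ _ N) => //.
  - by move=> y; rewrite mulr_ge0.
  - by move=> y; rewrite mulr_ge0.
  - by move=> y /psiE ->.
exists psi; split => //.
(* A zero integral would make [psi], hence [phi], vanish almost everywhere. *)
- rewrite lt_neqAle Rintegral_ge0// andbT eq_sym; apply/negP => /eqP int0.
  apply: phin0.
  have : (\int[lebesgue_rV n]_y `|(psi y)%:E|)%E = 0%E.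
    under eq_integral do rewrite gee0_abs ?lee_fin//.
    rewrite -[LHS]fineK; first by congr (_%:E).
    exact: integrable_fin_num ipsi.
  move=> /ae_eq_integral_abs => /(_ measurableT).
  have /measurable_EFinP mE := mpsi.
  move=> /(_ mE)[M [mM M0 MP]].
  exists (N `|` M); split.
  + exact: measurableU.
  + by rewrite -N0; apply: measureU0.
  + move=> y /= H.
    have [Ny|Ny] := pselect (N y); [by left|right].
    apply: MP => /= /(_ Logic.I) [] psiy0; apply: H.
    by rewrite psiE.
- have := intE (fun=> 1) (fun=> ler01); rewrite /mass.
  by under eq_Rintegral do rewrite mul1r; move=> ->;
    under eq_Rintegral do rewrite mul1r.
split; last by move=> x t t0; rewrite U_half// intE// => y; exact: expR_ge0.
(* On the cube [sqnorm y] is at most [n * b ^+ 2], which is at most [(b * n) ^+ 2] for natural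
   [n]. *)
exists (b * n%:R); first by rewrite mulr_ge0.
move=> y yn0; have yK := psiK _ yn0.
apply: (@le_trans _ _ (\sum_(i < n) b ^+ 2)).
  apply: ler_sum => i _; have := yK i; rewrite /= in_itv/= -ler_norml => yi.
  by rewrite -real_normK ?num_real// lerXn2r// nnegrE.
rewrite sumr_const card_ord -[leLHS]mulr_natr exprMn ler_wpM2l ?sqr_ge0//.
by rewrite -natrX ler_nat -mulnn; case: (n) => // m; rewrite leq_pmulr.
Qed.

End classL.

(** * One-variable calculus *)

Section second_order.
Context {R : realType}.
Implicit Types g : R -> R.

Lemma derivable_mean_value g (g1 : R -> R) (b c : R) :
  (forall s : R, is_derive s 1 g (g1 s)) -> b < c ->
  exists2 x, b < x < c & g c - g b = g1 x * (c - b).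
Proof.
move=> dg bc.
have [x] := MVT bc (fun s _ => dg s)
  (derivable_within_continuous (fun s _ => @ex_derive _ _ _ _ _ _ _ (dg s))).
by rewrite in_itv/= => xbc e; exists x.
Qed.

(** The mean value theorem on [[0, mu]] and on [[mu, 1]] gives slopes [g1 c1] and [g1 c2] with
    [c1 < c2]; a third use, for [g1], shows that the slopes decrease. *)
Lemma concave_of_second_derivative g (g1 g2 : R -> R) (mu : R) :
  (forall s : R, is_derive s 1 g (g1 s)) -> (forall s : R, is_derive s 1 g1 (g2 s)) ->
  (forall s, g2 s <= 0) -> 0 < mu < 1 ->
  (1 - mu) * g 0 + mu * g 1 <= g mu.
Proof.
move=> dg dg1 g2le /andP[mu0 mu1].
have [c1 /andP[_ c1mu] e1] := derivable_mean_value _ _ _ _ dg mu0.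
have [c2 /andP[muc2 _] e2] := derivable_mean_value _ _ _ _ dg mu1.
have c12 : c1 < c2 by exact: lt_trans muc2.
have [c3 _ e3] := derivable_mean_value _ _ _ _ dg1 c12.
have le12 : g1 c2 <= g1 c1.
  by rewrite -subr_le0 e3 mulr_le0_ge0// subr_ge0 ltW.
rewrite -subr_ge0.
have -> : g mu - ((1 - mu) * g 0 + mu * g 1) =
    (1 - mu) * (g mu - g 0) - mu * (g 1 - g mu) by ring.
have -> : (1 - mu) * (g mu - g 0) - mu * (g 1 - g mu) =
    mu * (1 - mu) * (g1 c1 - g1 c2) by rewrite e1 e2; ring.
apply: mulr_ge0; last by rewrite subr_ge0.
by rewrite mulr_ge0 ?subr_ge0 ?ltW.
Qed.

(** If [l > 0], then [g1 (s - h) < g1 s < g1 (s + h)] for small [h > 0], so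
    [h |-> g (s + h) + g (s - h)] has positive derivative there and exceeds its value [2 * g s] at
    0. *)
Lemma second_derivative_le0 g (g1 : R -> R) (s l : R) :
  (forall x : R, is_derive x 1 g (g1 x)) -> is_derive s 1 g1 l ->
  (forall h, g (s + h) + g (s - h) <= 2 * g s) -> l <= 0.
Proof.
move=> dg [dg1 <-] midg; rewrite leNgt; apply/negP => l0.
have : h^-1 *: (g1 (h *: 1 + s) - g1 s) @[h --> 0^'] --> 'D_1 g1 s := dg1.
move=> /cvgr_gt /(_ _ l0) [e /= e0 he].
have pos h : h != 0 -> `|h| < e -> 0 < h^-1 * (g1 (h + s) - g1 s).
  move=> h0 he'; have := he h; rewrite /= sub0r normrN => /(_ he' h0).
  by rewrite /GRing.scale/= mulr1.
pose k h := g (s + h) + g (s - h).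
have dk (h : R) : is_derive h 1 k (g1 (s + h) - g1 (s - h)).
  have d1 : is_derive h 1 (g \o (fun x => s + x)) (g1 (s + h) * 1).
    apply: is_derive1_comp.
    by apply: is_derive_eq; ring.
  have d2 : is_derive h 1 (g \o (fun x => s - x)) (g1 (s - h) * -1).
    apply: is_derive1_comp.
    by apply: is_derive_eq; ring.
  have -> : g1 (s + h) - g1 (s - h) = g1 (s + h) * 1 + g1 (s - h) * -1 by ring.
  exact: is_deriveD.
have e20 : 0 < e / 2 by rewrite divr_gt0.
have [c /andP[c0 ce] ec] := derivable_mean_value _ _ _ _ dk e20.
have cne : c != 0 by rewrite gt_eqF.
have ce' : `|c| < e by rewrite gtr0_norm//; lra.
have := pos _ cne ce'.
rewrite pmulr_rgt0 ?invr_gt0// subr_gt0 => p1.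
have := pos (- c); rewrite oppr_eq0 normrN => /(_ cne ce').
rewrite invrN mulNr -mulrN pmulr_rgt0 ?invr_gt0// opprB subr_gt0 => p2.
have : 0 < k (e / 2) - k 0.
  by rewrite ec mulr_gt0 ?subr0// subr_gt0 (addrC s) addrC (addrC s c) (lt_trans _ p1)// addrC.
by have := midg (e / 2); rewrite /k subr0 addr0; lra.
Qed.

End second_order.

(** * Derivatives of [calF] and the concavity criterion in terms of [kappa] *)

Section calF_derivatives.
Context {R : realType} (a : R) (F : R -> \bar R).
Hypotheses (ha : 0 < a) (hC2 : C2_on a (fine \o F))
  (hF' : forall s, 0 < s < a -> 0 < derive1 (fine \o F) s).

Let f := fine \o F.
Let e (r : R) := a * expR (- r).

Let e_itv r : 0 < r -> 0 < e r < a.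
Proof.
by move=> r0; rewrite mulr_gt0 ?expR_gt0//= gtr_pMr// expR_lt1 oppr_lt0.
Qed.

Let de (r : R) : is_derive r 1 e (- e r).
Proof. by apply: is_derive_eq; rewrite /e /GRing.scale/=; ring. Qed.

Let calF1 (r : R) : 0 < r ->
  is_derive r 1 (calF a F) (derive1 f (e r) * - e r).
Proof.
move=> r0; have [df _ _] := hC2 _ (e_itv _ r0).
have -> : calF a F = f \o e by [].
have d1 : is_derive (e r) 1 f (derive1 f (e r)).
  by rewrite derive1E; exact: derivableP.
exact: is_derive1_comp.
Qed.

Let calF1E (r : R) : 0 < r -> derive1 (calF a F) r = derive1 f (e r) * - e r.
Proof. by move=> r0; have d := calF1 _ r0; rewrite derive1E derive_val. Qed.

Lemma is_derive_calF (r : R) : 0 < r ->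
  is_derive r 1 (calF a F) (derive1 (calF a F) r).
Proof. by move=> r0; rewrite calF1E//; exact: calF1. Qed.

Lemma is_derive_calF1 (r : R) : 0 < r ->
  is_derive r 1 (derive1 (calF a F)) (derive1 (derive1 (calF a F)) r).
Proof.
move=> r0; have [_ df1 _] := hC2 _ (e_itv _ r0).
rewrite derive1E; apply: derivableP.
(* The chain rule formula for the first derivative is known only at positive arguments, hence only
   near [r]. *)
apply: (@near_eq_derivable _ _ _ ((derive1 f \o e) * (- e))).
  near=> x; rewrite calF1E//.
  by near: x; exact: lt_nbhsr.
apply: derivableM; last exact: ex_derive.
have d1 : is_derive (e r) 1 (derive1 f) ('D_1 (derive1 f) (e r)) by exact: derivableP.
exact: ex_derive.
Unshelve. end_near. Qed.

Lemma calF1_lt0 (r : R) : 0 < r -> derive1 (calF a F) r < 0.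
Proof.
move=> r0; rewrite calF1E// mulrN oppr_lt0.
have ei := e_itv _ r0; have f0 := hF' _ ei; have /andP[e0 _] := ei.
exact: mulr_gt0.
Qed.

(** The conclusion bounds the second derivative of [calF] composed with a function whose value and
    derivatives are [r], [r1], [r2]. Times [r], it equals [- calF'(r) * (kappa(r) * r1 ^+ 2 - r *
    r2)], where [- calF'(r) > 0]. *)
Lemma calF_comp_second_derivative_le0 (r r1 r2 c : R) : 0 < r ->
  kappa a F r <= c -> c * r1 ^+ 2 <= r * r2 ->
  derive1 (derive1 (calF a F)) r * r1 ^+ 2 + derive1 (calF a F) r * r2 <= 0.
Proof.
move=> r0; rewrite /kappa; have := calF1_lt0 _ r0.
set p := derive1 (calF a F) r; set q := derive1 (derive1 _) r => p0.
rewrite ler_ndivrMr// => qc cr; rewrite -(pmulr_rle0 _ r0).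
have h1 : r * q * r1 ^+ 2 <= - c * p * r1 ^+ 2.
  by rewrite ler_wpM2r ?sqr_ge0//; lra.
have h2 : p * (r * r2) <= p * (c * r1 ^+ 2) by rewrite ler_wnM2l// ltW.
lra.
Qed.

End calF_derivatives.

(** * Scalar inequalities for large times; the limsup of [kappa] *)

Section heat_profile.
Context {R : realType}.

(* With [q = |x| / (2 sqrt t)] and [e] of order [1 / sqrt t], the quantity
   [q ^+ 2 - 2 * q * e + delta] is a lower bound for [- ln (u / a)]. *)
Lemma eventually_gaussian_dominates (k K0 delta : R) :
  0 <= k < 1 / 2 -> 0 < delta ->
  exists2 e0, 0 < e0 & forall e q, 0 <= e <= e0 -> 0 <= q ->
    let m := q ^+ 2 - 2 * q * e + delta in
    [/\ 0 < m, 2 * e ^+ 2 <= 1 &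
     (K0 < m /\ 2 * k * (q + e) ^+ 2 <= (1 - 2 * e ^+ 2) * m) \/
     (q + e) ^+ 2 <= (1 - 2 * e ^+ 2) * m].
Proof.
move=> /andP[k0 k1] d0.
(* Threshold between bounded and large [q]: beyond it [m >= q ^+ 2 / 2 > Q / 2 > K0]. *)
pose Q := 1 + 2 * `|K0|.
have K00 := normr_ge0 K0; have K0le := ler_norm K0.
have Q1 : 1 <= Q by rewrite /Q; lra.
(* [D] collects the coefficients of all errors of order [e] when [q <= Q]; with [e * D <= delta]
   they are absorbed by [delta]. *)
pose D := 4 * Q + 1 + 2 * Q ^+ 2 + 2 * delta.
have D0 : 0 < D by rewrite /D; nra.
(* The bound by [(1 - 2 * k) / 7] gives [2 * k * (1 + 3 * e) <= 1 - 4 * e], needed for large [q];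
   [1 / 4] serves the crude estimates and [delta / D] the bounded [q]. *)
exists (Num.min ((1 - 2 * k) / 7) (Num.min (1 / 4) (delta / D))).
  by rewrite !lt_min !divr_gt0//; lra.
move=> e q; rewrite !le_min => /andP[ege0 /and3P[ek e14 eD]] q0 m.
have {}eD : e * D <= delta by rewrite -ler_pdivlMr.
have [qQ|Qq] := leP q Q.
  have qe : q * e <= Q * e by rewrite ler_wpM2r.
  have q2 : q ^+ 2 <= Q ^+ 2 by rewrite lerXn2r// nnegrE; lra.
  have e2 : e ^+ 2 <= e by nra.
  have ed : e * (q ^+ 2 + delta) <= e * (Q ^+ 2 + delta).
    by rewrite ler_wpM2l// lerD2r.
  have eed : e ^+ 2 * (q ^+ 2 + delta) <= e * (q ^+ 2 + delta).
    by rewrite ler_wpM2r// addr_ge0 ?sqr_ge0// ltW.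
  (* This is the second alternative after cancelling [q ^+ 2] and dropping the favourable term
     [4 * e ^+ 2 * (q * e)]. *)
  have key : 4 * q * e + e ^+ 2 + 2 * e ^+ 2 * (q ^+ 2 + delta) <= delta.
    by apply: le_trans eD; rewrite /D; nra.
  have h : (q + e) ^+ 2 <= (1 - 2 * e ^+ 2) * m.
    have : 0 <= 4 * e ^+ 2 * (q * e).
      by rewrite !mulr_ge0 ?sqr_ge0.
    rewrite /m; nra.
  split; [|nra|by right].
  have : 0 < delta * (1 - e ^+ 2); last rewrite /m.
    by rewrite mulr_gt0//; nra.
  have : 0 <= q ^+ 2 by rewrite sqr_ge0.
  have : 2 * q * e <= delta / 2 by nra.
  by lra.
(* For large [q] both sides of the first alternative are compared with multiples of [q ^+ 2]. *)
have q1 : 1 < q by lra.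
have eq : e * q <= e * q ^+ 2 by rewrite ler_wpM2l//; nra.
have mlow : (1 - 2 * e) * q ^+ 2 <= m by rewrite /m; nra.
have q22 : q ^+ 2 / 2 <= (1 - 2 * e) * q ^+ 2.
  by have := sqr_ge0 q; nra.
split; [nra|nra|left; split].
  have : q ^+ 2 > Q by nra.
  by rewrite /Q; lra.
have h1 : (q + e) ^+ 2 <= (1 + 3 * e) * q ^+ 2.
  have : e ^+ 2 <= e / 4 by nra.
  have : e <= e * q ^+ 2 by rewrite ler_peMr//; nra.
  nra.
have h2 : (1 - 4 * e) * q ^+ 2 <= (1 - 2 * e ^+ 2) * m.
  have : (1 - 2 * e ^+ 2) * ((1 - 2 * e) * q ^+ 2) <= (1 - 2 * e ^+ 2) * m.
    by rewrite ler_wpM2l//; nra.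
  apply: le_trans; rewrite mulrA ler_wpM2r ?sqr_ge0//.
  have : e ^+ 2 <= e / 4 by nra.
  have : 0 <= e ^+ 3 by rewrite exprn_ge0.
  by rewrite !exprS expr0; nra.
apply: le_trans h2; apply: (@le_trans _ _ (2 * k * ((1 + 3 * e) * q ^+ 2))).
  by rewrite ler_wpM2l// mulr_ge0.
rewrite mulrA ler_wpM2r ?sqr_ge0//; nra.
Qed.

Lemma kappa_star_lt_half (a : R) (F : R -> \bar R) :
  (kappa_star a F < (1 / 2)%:E)%E ->
  exists k K0, 0 <= k < 1 / 2 /\ forall r, K0 < r -> kappa a F r <= k.
Proof.
rewrite /kappa_star /limf_esup => /ereal_inf_lt[_ [V [K0 [_ VK]] <-]] supV.
have ub r : K0 < r ->
    ((kappa a F r)%:E <= ereal_sup [set (kappa a F r)%:E | r in V])%E.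
  by move=> /VK Vr; apply: ereal_sup_ubound; exists r.
move: supV ub; case: (ereal_sup _) => [c| |]//; rewrite ?lte_fin => c2 ub.
(* The maximum secures [0 <= k], as the supremum [c] may be negative. *)
- exists (Num.max c 0), K0; split; last first.
    by move=> r /ub; rewrite lee_fin le_max => ->.
  by rewrite le_max lexx orbT gt_max c2/=; lra.
- exists 0, K0; split; first by lra.
  by move=> r /ub; rewrite leeNy_eq.
Qed.

End heat_profile.

(** * Eventual F-concavity *)

Section log_heat_line.
Context {R : realType} {n : nat}.
Variables (psi : 'rV[R]_n -> R) (S t : R).
Hypotheses (psi0 : forall y, 0 <= psi y)
  (ipsi : (lebesgue_rV n).-integrable setT (EFin \o psi))
  (psi_gt0 : 0 < \int[lebesgue_rV n]_y psi y)
  (S0 : 0 <= S) (psiS : forall y, psi y != 0 -> sqnorm y <= S ^+ 2)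
  (t0 : 0 < t).

Let u (p : 'rV[R]_n) : R :=
  \int[lebesgue_rV n]_y (expR (- (sqnorm (p - y) / (4 * t))) * psi y).

Let t4 : 0 < 4 * t. Proof. by rewrite mulr_gt0. Qed.

Let t2V : 0 <= (2 * t)^-1. Proof. by rewrite invr_ge0 mulr_ge0// ltW. Qed.

Let sqrt_sqnorm (p : 'rV[R]_n) : Num.sqrt (sqnorm p) ^+ 2 = sqnorm p.
Proof. by rewrite sqr_sqrtr// sqnorm_ge0. Qed.

Let dot_le p y : psi y != 0 -> `|dot_rV p y| <= Num.sqrt (sqnorm p) * S.
Proof.
move=> y0; apply: dot_rV_le => //; rewrite ?sqrtr_ge0 ?sqrt_sqnorm//.
exact: psiS.
Qed.

(** By Cauchy-Schwarz, [sqnorm (p - y)] is at least [|p|^2 - 2 |p| S] wherever [psi y] is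
    nonzero. *)
Lemma gauss_le p :
  u p <= expR (- ((sqnorm p - 2 * Num.sqrt (sqnorm p) * S) / (4 * t))) *
    \int[lebesgue_rV n]_y psi y.
Proof.
apply: weighted_le => //; first exact: measurable_gauss.
move=> y y0; rewrite expR_ge0/= ler_expR lerN2 ler_pM2r ?invr_gt0//.
have := dot_le p y y0; rewrite ler_norml => /andP[_ h].
by have := sqnorm_ge0 y; rewrite sqnormB; lra.
Qed.

(** Where [psi] is nonzero, [|p - y| <= |p| + S] bounds the Gaussian below by a positive constant,
    and [psi] has positive mass. *)
Lemma gauss_gt0 p : 0 < u p.
Proof.
pose P := Num.sqrt (sqnorm p).
apply: (@lt_le_trans _ _
    (expR (- ((sqnorm p + 2 * (P * S) + S ^+ 2) / (4 * t))) *
     \int[lebesgue_rV n]_y psi y)); first by rewrite mulr_gt0 ?expR_gt0.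
apply: (weighted_ge _ _ _ _ _ _ _ _ _ 1) => //; first exact: measurable_gauss.
move=> y y0; apply/andP; split; last first.
  by rewrite -[leRHS]expR0 ler_expR oppr_le0 divr_ge0 ?sqnorm_ge0// ltW.
rewrite ler_expR lerN2 ler_pM2r ?invr_gt0// sqnormB.
have := dot_le p y y0; rewrite ler_norml => /andP[h _].
by have := psiS y y0; rewrite /P; lra.
Qed.

Variables x v : 'rV[R]_n.

(** Expanding [sqnorm (x + s *: v - y)] leaves three factors: a Gaussian in [x + s *: v], this
    [weight] free of [s], and [exp(s w)]. *)
Let weight y := expR ((2 * dot_rV x y - sqnorm y) / (4 * t)) * psi y.
Let w y := dot_rV v y / (2 * t).
Let L k s := laplace_moment _ _ _ (lebesgue_rV n) weight w k s.
Let B := Num.sqrt (sqnorm v) * S / (2 * t).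

Let weight0 y : 0 <= weight y.
Proof. by rewrite mulr_ge0// expR_ge0. Qed.

Let iweight : (lebesgue_rV n).-integrable setT (EFin \o weight).
Proof.
apply: (integrable_weighted _ _ _ _ _ ipsi
  (fun y => expR ((2 * dot_rV x y - sqnorm y) / (4 * t)))
  (expR (2 * (Num.sqrt (sqnorm x) * S) / (4 * t)))).
  apply: measurableT_comp => //; apply: measurable_funM => //.
  apply: measurable_funB; last exact: measurable_sqnorm.
  by apply: measurable_funM => //; exact: measurable_dot_rV.
move=> y y0; rewrite ger0_norm ?expR_ge0// ler_expR ler_pM2r ?invr_gt0//.
have := dot_le x y y0; rewrite ler_norml => /andP[_ h].
by have := sqnorm_ge0 y; lra.
Qed.

Let mw : measurable_fun setT w.
Proof. by apply: measurable_funM => //; exact: measurable_dot_rV. Qed.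

Let wB y : weight y != 0 -> `|w y| <= B.
Proof.
rewrite mulf_eq0 negb_or => /andP[_ y0].
rewrite normrM (ger0_norm t2V).
by rewrite ler_wpM2r// dot_le.
Qed.

Let gaussE s : u (x + s *: v) =
  expR (- (sqnorm (x + s *: v) / (4 * t))) * L 0 s.
Proof.
rewrite /L /laplace_moment -RintegralZl//; last first.
  apply: (integrable_weighted _ _ _ _ _ iweight
    (fun y => w y ^+ 0 * expR (s * w y)) (expR (`|s| * B))).
    apply: measurable_funM => //; apply: measurableT_comp => //.
    exact: measurable_funM.
  move=> y y0; rewrite expr0 mul1r ger0_norm ?expR_ge0// ler_expR.
  by rewrite (le_trans (ler_norm _))// normrM ler_wpM2l// wB.
apply: eq_Rintegral => y _; rewrite expr0 mul1r /weight !mulrA -!expRD.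
congr (expR _ * _); rewrite sqnormB dot_rV_line /w; field.
by rewrite gt_eqF.
Qed.

Let L0_gt0 s : 0 < L 0 s.
Proof. by have := gauss_gt0 (x + s *: v); rewrite gaussE pmulr_rgt0 ?expR_gt0. Qed.

(** Here [- ln u] is a quadratic polynomial in [s] minus [ln (L 0 s)]. The logarithm contributes the
    mean of [w] under the tilted measure to [r1] and its variance to [r2]; these are at most [B] in
    absolute value and [B ^+ 2]. *)
Lemma log_gauss_line_derivatives : exists r1 r2 : R -> R, forall s : R,
  let sigma := Num.sqrt (sqnorm v) in
  [/\ is_derive s 1 (fun s => - ln (u (x + s *: v))) (r1 s),
      is_derive s 1 r1 (r2 s),
      `|r1 s| <= sigma * (Num.sqrt (sqnorm (x + s *: v)) + S) / (2 * t) &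
      sigma ^+ 2 / (2 * t) * (1 - S ^+ 2 / (2 * t)) <= r2 s].
Proof.
have dL k (s : R) : is_derive s 1 (L k) (L k.+1 s).
  exact: (is_derive_laplace_moment _ _ _ _ _ weight0 iweight w B mw wB k s).
pose V := sqnorm v.
exists (fun s => (dot_rV x v + s * V) / (2 * t) - L 1%N s / L 0%N s).
exists (fun s => V / (2 * t) -
  (L 2 s * L 0%N s - L 1%N s ^+ 2) / L 0%N s ^+ 2) => s sigma.
have L0n (z : R) : L 0%N z != 0 by rewrite gt_eqF.
have tn0 : t != 0 by rewrite gt_eqF.
split.
- have -> : (fun s => - ln (u (x + s *: v))) = (fun s =>
      (sqnorm x + 2 * s * dot_rV x v + s ^+ 2 * V) / (4 * t) - ln (L 0%N s)).
    apply/funext => z; rewrite gaussE lnM ?posrE ?expR_gt0// expRK sqnorm_line.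
    by rewrite opprD opprK.
  have d1 : is_derive s 1 (@ln R \o L 0%N) ((L 0%N s)^-1 * L 1%N s).
    by apply: is_derive1_comp; exact: is_derive1_ln.
  apply: is_derive_eq; rewrite /GRing.scale/=; field.
  by rewrite L0n tn0.
- apply: is_derive_eq; rewrite /GRing.scale/=; field.
  by rewrite L0n tn0.
- have -> : (dot_rV x v + s * V) / (2 * t) - L 1%N s / L 0%N s =
      dot_rV (x + s *: v) v / (2 * t) - L 1%N s / L 0%N s.
    suff -> : V = dot_rV v v by rewrite dot_rV_line.
    by apply: eq_bigr => i _; rewrite expr2.
  rewrite (le_trans (ler_normB _ _))// mulrDr mulrDl lerD//.
    rewrite normrM (ger0_norm t2V).
    rewrite ler_wpM2r// mulrC.
    by apply: dot_rV_le; rewrite ?sqrtr_ge0 ?sqrt_sqnorm.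
  rewrite normf_div (gtr0_norm (L0_gt0 s)) ler_pdivrMr//.
  exact: (laplace_moment1_le _ _ _ _ _ weight0 iweight w B mw wB).
(* The variance is bounded by the second moment. *)
- have : (L 2 s * L 0%N s - L 1%N s ^+ 2) / L 0%N s ^+ 2 <= B ^+ 2.
    rewrite ler_pdivrMr ?exprn_gt0//.
    have := laplace_moment2_le _ _ _ _ _ weight0 iweight w B mw wB s.
    rewrite -/(L 2 s) -/(L 0%N s) => h.
    have : L 2 s * L 0%N s <= B ^+ 2 * L 0%N s * L 0%N s.
      by rewrite ler_wpM2r// ltW.
    by have := sqr_ge0 (L 1%N s); lra.
  rewrite sqrt_sqnorm -/V => h.
  have -> : V / (2 * t) * (1 - S ^+ 2 / (2 * t)) = V / (2 * t) - B ^+ 2.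
    by rewrite /B !exprMn sqrt_sqnorm -/V; field.
  by rewrite lerD2l lerN2.
Qed.

End log_heat_line.

(** * From the bounds on [kappa] to eventual concavity *)

Section eventual_concavity.
Context {R : realType}.
Variables (a : R) (F : R -> \bar R).
Hypotheses (ha : 0 < a) (hF : admissible a F).

Lemma admissible_fin (s : R) : 0 < s < a -> F s = (fine (F s))%:E.
Proof.
move=> /andP[s0 sa]; have [Floo _ Fmono F0] := hF.
have := Fmono _ _ (lexx 0) s0 sa; rewrite F0 => Fs.
by rewrite fineK// fin_real// Fs Floo// ltW//.
Qed.

Lemma F_calF (s : R) : 0 < s < a -> F s = (calF a F (ln a - ln s))%:E.
Proof.
move=> s0a; have /andP[s0 _] := s0a; rewrite admissible_fin// /calF.
by rewrite opprB expRB !lnK ?posrE// mulrCA divff ?mulr1// gt_eqF.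
Qed.

Hypotheses (hC2 : C2_on a (fine \o F))
  (hF' : forall s, 0 < s < a -> 0 < derive1 (fine \o F) s).

Lemma eventually_F_concave_of_kappa n (phi : 'rV[R]_n -> R) :
  (forall r, 0 < r -> kappa a F r <= 1 / 2) ->
  (kappa_star a F < (1 / 2)%:E)%E ->
  classL phi -> mass phi < a -> eventually_F_concave a F (n%:R / 2) phi.
Proof.
move=> kle /kappa_star_lt_half[k [K0 [k01 kK]]].
move=> /classL_borel[psi [psi0 ipsi psi_gt0 -> [[S S0 psiS] UE]]] Ma.
set M := \int[lebesgue_rV n]_y psi y in psi_gt0 Ma.
pose delta := ln a - ln M.
have d0 : 0 < delta by rewrite subr_gt0 ltr_ln ?posrE.
have [e0 e00 dom] := eventually_gaussian_dominates k K0 delta k01 d0.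
(* For [t] beyond the square one has [e = S / (2 sqrt t) <= e0]; the added 1 keeps the time positive
   when [S = 0]. *)
exists ((S / (2 * e0)) ^+ 2 + 1); first by rewrite ltr_wpDl// sqr_ge0.
move=> t tT.
have t0 : 0 < t by apply: lt_le_trans tT; rewrite ltr_wpDl// sqr_ge0.
pose st := Num.sqrt t.
pose e := S / (2 * st).
have st0 : 0 < st by rewrite sqrtr_gt0.
have stE : st ^+ 2 = t by rewrite sqr_sqrtr// ltW.
have e_ge0 : 0 <= e by rewrite divr_ge0// mulr_ge0// ltW.
have ee0 : 0 <= e <= e0.
  rewrite e_ge0/= ler_pdivrMr ?mulr_gt0//.
  have e02 : 0 < 2 * e0 by rewrite mulr_gt0.
  have : S / (2 * e0) <= st.
    have Se0 : 0 <= S / (2 * e0) by rewrite divr_ge0// ltW.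
    rewrite -(@ler_pXn2r _ 2)// ?nnegrE ?sqrtr_ge0//.
    by rewrite stE; lra.
  by rewrite ler_pdivrMr//; lra.
have [u uE] : exists u, u = fun p => U (n%:R / 2) phi p t by eexists.
rewrite -uE.
have {}UE p : u p =
    \int[lebesgue_rV n]_y (expR (- (sqnorm (p - y) / (4 * t))) * psi y).
  by rewrite uE UE.
pose q (p : 'rV[R]_n) := Num.sqrt (sqnorm p) / (2 * st).
have q0 p : 0 <= q p by rewrite divr_ge0 ?mulr_ge0 ?sqrtr_ge0.
pose m p := q p ^+ 2 - 2 * q p * e + delta.
pose rho p := ln a - ln (u p).
have u0 p : 0 < u p.
  by rewrite UE; exact: (gauss_gt0 psi S t psi0 ipsi psi_gt0 S0 psiS t0).
have mrho p : m p <= rho p.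
  have := gauss_le psi S t psi0 ipsi S0 psiS t0 p.
  rewrite -UE -/M => ule.
  have : ln (u p) <= ln (expR (- ((sqnorm p - 2 * Num.sqrt (sqnorm p) * S) / (4 * t))) * M).
    have := mulr_gt0 (expR_gt0 _) psi_gt0 => hM.
    by rewrite ler_ln ?posrE ?u0 ?hM.
  rewrite lnM ?posrE ?expR_gt0// expRK.
  suff -> : (sqnorm p - 2 * Num.sqrt (sqnorm p) * S) / (4 * t) =
    q p ^+ 2 - 2 * q p * e by rewrite /m /rho /delta; lra.
  rewrite /q /e -stE; have := @sqr_sqrtr _ (sqnorm p) (sqnorm_ge0 p).
  set P := Num.sqrt (sqnorm p) => <-; field.
  by rewrite gt_eqF.
have rho0 p : 0 < rho p.
  by have [m0 _ _] := dom e (q p) ee0 (q0 p); exact: lt_le_trans (mrho p).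
have ua p : 0 < u p < a.
  by rewrite u0/=; have := rho0 p; rewrite subr_gt0 ltr_ln ?posrE.
split=> [x|x y mu mu01]; first by have /andP[/ltW -> ->] := ua x.
(* Concavity is checked along the segment from [x] to [y], which reduces it to one variable. *)
pose v := y - x; pose p s := x + s *: v.
have pmu : (1 - mu) *: x + mu *: y = p mu.
  by apply/rowP => i; rewrite !mxE; ring.
have p0 : p 0 = x by rewrite /p scale0r addr0.
have p1 : p 1 = y by rewrite /p /v scale1r subrKC.
rewrite pmu (F_calF _ (ua x)) (F_calF _ (ua y)).
rewrite (F_calF _ (ua (p mu))) -!EFinM -EFinD lee_fin.
rewrite -/(rho x) -/(rho y) -/(rho (p mu)) -p0 -p1.
have [r1 [r2 rd]] :=
  log_gauss_line_derivatives psi S t psi0 ipsi psi_gt0 S0 psiS t0 x v.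
have drho (s : R) : is_derive s 1 (rho \o p) (r1 s).
  have [d1 _ _ _] := rd s.
  have -> : rho \o p = cst (ln a) + (fun s => - ln (u (x + s *: v))).
    by apply/funext => z; rewrite /rho /p.
  have -> : (fun s => - ln (u (x + s *: v))) = (fun s => - ln
      (\int[lebesgue_rV n]_y (expR (- (sqnorm (x + s *: v - y) / (4 * t))) * psi y))).
    by apply/funext => z; rewrite UE.
  by apply: is_derive_eq; rewrite add0r.
apply: (concave_of_second_derivative (calF a F \o (rho \o p))
  (fun s => derive1 (calF a F) (rho (p s)) * r1 s)
  (fun s => derive1 (derive1 (calF a F)) (rho (p s)) * r1 s ^+ 2 +
     derive1 (calF a F) (rho (p s)) * r2 s)) => //.
- move=> s.
  exact: (@is_derive1_comp _ (calF a F) (rho \o p) s _ _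
    (is_derive_calF a F ha hC2 _ (rho0 (p s))) (drho s)).
- move=> s; have [_ d2 _ _] := rd s.
  have d1 : is_derive s 1 (derive1 (calF a F) \o (rho \o p))
      (derive1 (derive1 (calF a F)) (rho (p s)) * r1 s).
    exact: (@is_derive1_comp _ (derive1 (calF a F)) (rho \o p) s _ _
      (is_derive_calF1 a F ha hC2 _ (rho0 (p s))) (drho s)).
  have dM := is_deriveM d1 d2.
  by apply: (is_derive_eq dM); rewrite /GRing.scale/=; ring.
move=> s; have [_ _ r1le r2ge] := rd s.
have [m0 e2 mdom] := dom e (q (p s)) ee0 (q0 (p s)).
rewrite -/(m _) in m0 mdom.
set sigma := Num.sqrt (sqnorm v) in r1le r2ge.
set qe := q (p s) + e in mdom.
have r1sq : r1 s ^+ 2 <= sigma ^+ 2 / t * qe ^+ 2.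
  have -> : sigma ^+ 2 / t * qe ^+ 2 =
      (sigma * (Num.sqrt (sqnorm (x + s *: v)) + S) / (2 * t)) ^+ 2.
    by rewrite /qe /q /e -/(p s) -stE; field; rewrite gt_eqF.
  rewrite -[leLHS]real_normK ?num_real// lerXn2r// nnegrE.
  exact: le_trans r1le.
have r2m : sigma ^+ 2 / (2 * t) * (1 - 2 * e ^+ 2) <= r2 s.
  apply: le_trans r2ge; rewrite le_eqVlt; apply/orP; left; apply/eqP.
  by rewrite /e -stE; field; rewrite gt_eqF.
have V0 : 0 <= sigma ^+ 2 / (2 * t).
  by rewrite divr_ge0 ?sqr_ge0// mulr_ge0// ltW.
have VE : sigma ^+ 2 / t = 2 * (sigma ^+ 2 / (2 * t)).
  by field; rewrite gt_eqF.
(* [W] is a common factor of the bounds on [r1 s ^+ 2] and [r2 s]; taking it out leaves the scalar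
   alternative [mdom]. *)
set W := sigma ^+ 2 / (2 * t) in r2m V0 VE; rewrite VE in r1sq.
have r2_0 : 0 <= r2 s by apply: le_trans r2m; rewrite mulr_ge0//; lra.
have rr : W * ((1 - 2 * e ^+ 2) * m (p s)) <= rho (p s) * r2 s.
  rewrite mulrA mulrC ler_pM//; first exact: ltW.
  by rewrite mulr_ge0//; lra.
have core c : 0 <= c -> kappa a F (rho (p s)) <= c ->
    2 * c * qe ^+ 2 <= (1 - 2 * e ^+ 2) * m (p s) ->
    derive1 (derive1 (calF a F)) (rho (p s)) * r1 s ^+ 2 +
      derive1 (calF a F) (rho (p s)) * r2 s <= 0.
  move=> c0 kc cq; apply: (calF_comp_second_derivative_le0 a F ha hC2 hF' _ _ _ c) => //.
  apply: le_trans rr; apply: (@le_trans _ _ (W * (2 * c * qe ^+ 2))).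
    have := ler_wpM2l c0 r1sq; lra.
  by rewrite ler_wpM2l.
have /andP[k0 _] := k01.
(* In the first case [rho > K0] and the asymptotic bound [k] applies; otherwise the global bound
   [1 / 2] suffices. *)
case: mdom => [[K0m kq]|hq].
  by apply: (core k) => //; apply: kK; exact: lt_le_trans (mrho _).
apply: (core (1 / 2) _ (kle _ (rho0 _))); first by rewrite divr_ge0.
by rewrite mul1r divff ?pnatr_eq0// mul1r.
Qed.

End eventual_concavity.

(** * Failure of eventual F-concavity *)

Section unit_cube_data.
Context {R : realType} {n : nat}.

Let mu := @lebesgue_rV R n.

Definition cube_data (c : R) (y : 'rV[R]_n) : R := c * \1_(cube_rV 0 1) y.

Variables (c : R).
Hypothesis c0 : 0 < c.

Let phi := cube_data c.

Let mcube : measurable (cube_rV 0 1 : set 'rV[R]_n).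
Proof. exact: measurable_cube_rV. Qed.

Let mphi : measurable_fun setT phi.
Proof. by apply: measurable_funM => //; exact: measurable_indic. Qed.

Let mu_cube : @lebesgue_rV R n (cube_rV 0 1) = (1%R)%:E.
Proof.
by apply: etrans (lebesgue_cube_rV 0 1 ler01) _; rewrite subr0 expr1n.
Qed.

Let cube_dataP y : phi y != 0 -> cube_rV 0 1 y.
Proof.
rewrite /phi /cube_data indicE.
by case: (boolP (y \in _)) => [/set_mem//|_]; rewrite mulr0 eqxx.
Qed.

Lemma cube_data_ge0 y : 0 <= cube_data c y.
Proof. by rewrite mulr_ge0// ltW. Qed.

Let phi_le y : phi y <= c.
Proof.
by rewrite /phi /cube_data indicE; case: (_ \in _);
  rewrite ?mulr1 ?mulr0// ltW.
Qed.

Lemma integrable_cube_data : mu.-integrable setT (EFin \o cube_data c).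
Proof.
apply: (integrable_cube_rV 0 1 c) => // y.
by rewrite cube_data_ge0 phi_le.
Qed.

Lemma mass_cube_data : mass (cube_data c) = c.
Proof.
rewrite /mass /cube_data /Rintegral.
under eq_integral do rewrite EFinM.
have m1 : measurable_fun setT
    (fun y : 'rV[R]_n => (\1_(cube_rV 0 1) y)%:E : \bar R).
  by apply/measurable_EFinP; exact: measurable_indic.
rewrite (ge0_integralZl _ _ m1) ?lee_fin ?ltW// integral_indic// setIT.
by rewrite [X in (_ * X)%E]mu_cube mule1.
Qed.

Lemma classL_cube_data : classL (cube_data c).
Proof.
split.
- move=> B mB; exists (phi @^-1` B).
    by rewrite -[X in measurable X]setTI; exact: mphi.
  by exists set0; [exact: negligible_set0|rewrite setU0].
- move=> [N [mN N0 subN]].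
  have : (lebesgue_rV n (cube_rV 0 1) <= lebesgue_rV n N)%E.
    apply: le_measure; rewrite ?inE// => y yK; apply: subN => /=.
    rewrite /cube_data indicE mem_set// mulr1; apply/eqP.
    by rewrite gt_eqF.
  by rewrite N0 [X in (X <= _)%E]mu_cube lee_fin ler10.
- exact: cube_data_ge0.
- by exists c.
have cK : compact (cube_rV 0 1 : set 'rV[R]_n).
  exact: (@rV_compact R n (fun=> `[0, 1]%classic)
    (fun=> @segment_compact R 0 1)).
apply: (subclosed_compact _ cK); first exact: closed_closure.
have /closure_id -> : closed (cube_rV 0 1 : set 'rV[R]_n).
  by apply: compact_closed => //; exact: norm_hausdorff.
by apply: closure_subset => y; exact: cube_dataP.
Qed.

(** At this point the Gaussian exponent is [s ^+ 2 - s (e . y) / st + |y|^2 / (4 st^2)]. On the unit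
    cube [|y|^2 <= n], so it differs from [s ^+ 2] by at most [err], uniformly in [y], and the bound
    survives integration. *)
Lemma log_U_cube_data (e : 'rV[R]_n) (s st : R) :
  sqnorm e = 1 -> 0 < st ->
  let u := U (n%:R / 2) (cube_data c) ((2 * st * s) *: e) (st ^+ 2) in
  let err := Num.sqrt n%:R * `|s| / st + n%:R / (4 * st ^+ 2) in
  0 < u /\ `|ln u - (ln c - s ^+ 2)| <= err.
Proof.
move=> e1 st0 u err.
have sqy y : cube_data c y != 0 -> sqnorm y <= n%:R.
  move=> /cube_dataP yK; apply: (@le_trans _ _ (\sum_(i < n) 1)).
    apply: ler_sum => i _; have := yK i; rewrite /= in_itv/= => /andP[? ?].
    by rewrite expr_le1.
  by rewrite sumr_const card_ord.
have sn0 : 0 <= Num.sqrt (n%:R : R) by exact: sqrtr_ge0.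
have snE : Num.sqrt (n%:R : R) ^+ 2 = n%:R by rewrite sqr_sqrtr.
have stp : 0 < (4 * st ^+ 2)^-1 by rewrite invr_gt0 mulr_gt0 ?exprn_gt0.
have q0 (y : 'rV[R]_n) : 0 <= sqnorm y / (4 * st ^+ 2).
  exact: mulr_ge0 (sqnorm_ge0 y) (ltW stp).
have close y : cube_data c y != 0 ->
    `|sqnorm ((2 * st * s) *: e - y) / (4 * st ^+ 2) - s ^+ 2| <= err.
  move=> y0.
  have dle : `|dot_rV e y| <= 1 * Num.sqrt n%:R.
    by apply: dot_rV_le => //; rewrite ?expr1n ?e1 ?snE// sqy.
  have -> : sqnorm ((2 * st * s) *: e - y) / (4 * st ^+ 2) - s ^+ 2 =
      - (s * dot_rV e y / st) + sqnorm y / (4 * st ^+ 2).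
    rewrite sqnormB -[_ *: e]add0r sqnorm_line dot_rV_line e1.
    have -> : dot_rV 0 e = 0 :> R.
      by rewrite /dot_rV big1// => i _; rewrite mxE mul0r.
    have -> : dot_rV 0 y = 0 :> R.
      by rewrite /dot_rV big1// => i _; rewrite mxE mul0r.
    have -> : sqnorm (0 : 'rV[R]_n) = 0.
      by rewrite /sqnorm big1// => i _; rewrite mxE expr0n.
    by field; rewrite gt_eqF.
  rewrite (le_trans (ler_normD _ _))// normrN lerD//.
    have stV : 0 < st^-1 by rewrite invr_gt0.
    rewrite !normrM (gtr0_norm stV) ler_pM2r// mulrC ler_wpM2r//.
    by rewrite -[leRHS]mul1r.
  by rewrite (ger0_norm (q0 y)) ler_pM2r// sqy.
have uE : u = \int[lebesgue_rV n]_y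
    (expR (- (sqnorm ((2 * st * s) *: e - y) / (4 * st ^+ 2))) * cube_data c y).
  by rewrite /u U_half// exprn_gt0.
have uge : expR (- s ^+ 2 - err) * c <= u.
  rewrite uE -[X in _ * X <= _]mass_cube_data.
  apply: (weighted_ge _ _ _ _ _ cube_data_ge0 integrable_cube_data _ _ 1).
  - exact: measurable_gauss.
  - exact: expR_ge0.
  move=> y y0; have := close y y0; rewrite ler_norml => /andP[h1 h2].
  apply/andP; split; first by rewrite ler_expR; lra.
  by rewrite -[leRHS]expR0 ler_expR oppr_le0.
have ule : u <= expR (- s ^+ 2 + err) * c.
  rewrite uE -[X in _ <= _ * X]mass_cube_data.
  apply: (weighted_le _ _ _ _ _ cube_data_ge0 integrable_cube_data).
    exact: measurable_gauss.
  move=> y y0; have := close y y0; rewrite ler_norml => /andP[h1 h2].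
  by rewrite expR_ge0/= ler_expR; lra.
have u0 : 0 < u by apply: lt_le_trans uge; rewrite mulr_gt0 ?expR_gt0.
clearbody u; split => //; rewrite ler_norml.
have : ln (expR (- s ^+ 2 - err) * c) <= ln u.
  by rewrite ler_ln ?posrE// mulr_gt0 ?expR_gt0.
have : ln u <= ln (expR (- s ^+ 2 + err) * c).
  by rewrite ler_ln ?posrE// mulr_gt0 ?expR_gt0.
by rewrite !lnM ?posrE ?expR_gt0// !expRK; lra.
Qed.

End unit_cube_data.

(** * Passage to the limiting Gaussian and contradiction *)

Section failure.
Context {R : realType}.
Variables (a : R) (F : R -> \bar R).
Hypotheses (ha : 0 < a) (hF : admissible a F)
  (hC2 : C2_on a (fine \o F))
  (hF' : forall s, 0 < s < a -> 0 < derive1 (fine \o F) s).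

(* At [x = 2 sqrt t s e] one has [u(x, t) -> a exp (- delta - s ^+ 2)] as
   [t -> oo], so that F-concavity passes to the limiting Gaussian. *)
Lemma gaussian_midpoint_concave n (delta : R) : (1 <= n)%N -> 0 < delta ->
  eventually_F_concave a F (n%:R / 2)
    (@cube_data R n (a * expR (- delta))) ->
  forall s h, calF a F (delta + (s + h) ^+ 2) + calF a F (delta + (s - h) ^+ 2)
    <= 2 * calF a F (delta + s ^+ 2).
Proof.
move=> n1 d0 [T T0 conc] s h.
set c := a * expR (- delta) in conc.
have c0 : 0 < c by rewrite mulr_gt0 ?expR_gt0.
have lnc : ln c = ln a - delta.
  by rewrite /c lnM ?posrE ?expR_gt0// expRK.
pose i0 : 'I_n := Ordinal n1.
pose e : 'rV[R]_n := delta_mx ord0 i0.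
have e1 : sqnorm e = 1.
  rewrite /sqnorm (bigD1 i0)//= mxE !eqxx expr1n big1 ?addr0// => i ii0.
  by rewrite mxE (negbTE ii0) andbF expr0n.
(* The times are the squares [st k ^+ 2], so the error is polynomial in the harmonic sequence. *)
pose st (k : nat) : R := k.+1%:R.
have [u uE] : exists u : R -> nat -> R, u = fun z k =>
  U (n%:R / 2) (cube_data c) ((2 * st k * z) *: e) (st k ^+ 2) by eexists.
pose rho z k := ln a - ln (u z k).
have ub z k : 0 < u z k /\ `|rho z k - (delta + z ^+ 2)| <=
    Num.sqrt n%:R * `|z| * k.+1%:R^-1 + n%:R / 4 * k.+1%:R^-1 ^+ 2.
  have [] := log_U_cube_data c c0 e z (st k) e1; first by rewrite ltr0n.
  rewrite uE /rho lnc => ? le_err; split => //; rewrite distrC.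
  have -> : n%:R / 4 * k.+1%:R^-1 ^+ 2 = n%:R / (4 * st k ^+ 2) :> R.
    have stn : st k != 0 by rewrite pnatr_eq0.
    by rewrite -/(st k); move: (st k) stn => x xn; field.
  apply: le_trans le_err; rewrite uE le_eqVlt; apply/orP; left; apply/eqP.
  by congr (`|_|); ring.
have rho_cvg z : rho z k @[k --> \oo] --> delta + z ^+ 2.
  have err0 : (fun k => Num.sqrt n%:R * `|z| * k.+1%:R^-1 +
      n%:R / 4 * k.+1%:R^-1 ^+ 2) @ \oo --> (0 : R).
    rewrite -[X in _ --> X](_ : Num.sqrt n%:R * `|z| * 0 + n%:R / 4 * (0 * 0) = 0);
      last by rewrite !mulr0 addr0.
    apply: cvgD; apply: cvgM; [exact: cvg_cst|exact: cvg_harmonic|exact: cvg_cst|].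
    by apply: cvgM; exact: cvg_harmonic.
  set err := (X in X @ _ --> _) in err0.
  have lo : delta + z ^+ 2 - err k @[k --> \oo] --> delta + z ^+ 2.
    by rewrite -[X in _ --> X]subr0; apply: cvgB => //; exact: cvg_cst.
  have up : delta + z ^+ 2 + err k @[k --> \oo] --> delta + z ^+ 2.
    by rewrite -[X in _ --> X]addr0; apply: cvgD => //; exact: cvg_cst.
  apply: (squeeze_cvgr _ lo up); apply: nearW => k.
  by have [_] := ub z k; rewrite ler_distl.
have calF_cvg z : calF a F (rho z k) @[k --> \oo] --> calF a F (delta + z ^+ 2).
  have p : 0 < delta + z ^+ 2 by rewrite ltr_wpDr ?sqr_ge0.
  have df := is_derive_calF a F ha hC2 _ p.
  have cf : {for (delta + z ^+ 2), continuous (calF a F)}.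
    apply: differentiable_continuous; apply/derivable1_diffP.
    exact: ex_derive.
  exact: (cvg_comp _ _ (rho_cvg z) cf).
have lhs : calF a F (rho (s + h) k) + calF a F (rho (s - h) k) @[k --> \oo] -->
    calF a F (delta + (s + h) ^+ 2) + calF a F (delta + (s - h) ^+ 2).
  exact: cvgD.
have rhs : 2 * calF a F (rho s k) @[k --> \oo] --> 2 * calF a F (delta + s ^+ 2).
  by apply: cvgM; [exact: cvg_cst|exact: calF_cvg].
apply: (ler_cvg_to lhs rhs).
near=> k.
have kT : T <= st k ^+ 2.
  have kT : T <= k%:R by near: k; exact: nbhs_infty_ger.
  have k1 : 1 <= st k by rewrite ler1n.
  have : st k = k%:R + 1 by rewrite /st -natr1.
  nra.
have [uran uconc] := conc _ kT.
have ua z : 0 < u z k < a.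
  by rewrite (ub z k).1/= uE; have /andP[] := uran ((2 * st k * z) *: e).
have half : 0 < (1 / 2 : R) < 1 by lra.
have := uconc ((2 * st k * (s + h)) *: e) ((2 * st k * (s - h)) *: e) (1 / 2) half.
have -> : (1 - 1 / 2) *: ((2 * st k * (s + h)) *: e) +
    (1 / 2) *: ((2 * st k * (s - h)) *: e) = (2 * st k * s) *: e.
  by rewrite !scalerA -scalerDl; congr (_ *: _); field.
have uEz z : U (n%:R / 2) (cube_data c) ((2 * st k * z) *: e) (st k ^+ 2) = u z k.
  by rewrite uE.
rewrite !uEz (F_calF a F ha hF _ (ua (s + h))) (F_calF a F ha hF _ (ua (s - h))).
rewrite (F_calF a F ha hF _ (ua s)) -!EFinM -EFinD lee_fin.
rewrite -/(rho (s + h) k) -/(rho (s - h) k) -/(rho s k).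
lra.
Unshelve. all: end_near. Qed.

Lemma not_eventually_F_concave_of_kappa n : (1 <= n)%N ->
  (exists2 r : R, 0 < r & 1 / 2 < kappa a F r) ->
  exists phi : 'rV[R]_n -> R, [/\ classL phi, mass phi < a &
    ~ eventually_F_concave a F (n%:R / 2) phi].
Proof.
move=> n1 [r r0]; have [k kE] : exists k : R, k = kappa a F r by eexists.
rewrite -kE => kr.
have k0 : 0 < k by lra.
(* Half of the critical value [r * (1 - 1 / (2 * k))], at which [2 * k * (r - delta) = r]; hence
   [2 * k * (r - delta) > r]. *)
pose delta := r * (1 - 1 / (2 * k)) / 2.
have k2 : 1 / (2 * k) < 1.
  by rewrite ltr_pdivrMr ?mulr_gt0//; lra.
have k2p : 0 < 1 / (2 * k) by rewrite divr_gt0 ?mulr_gt0.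
have d0 : 0 < delta by rewrite divr_gt0// mulr_gt0// subr_gt0.
have rd : 2 * k * (r - delta) = r * (k + 1 / 2).
  by rewrite /delta; field; rewrite gt_eqF.
have rd0 : 0 < r - delta.
  by rewrite -(pmulr_rgt0 _ (mulr_gt0 (ltr0n R 2) k0)) rd mulr_gt0//; lra.
pose c := a * expR (- delta).
have c0 : 0 < c by rewrite mulr_gt0 ?expR_gt0.
exists (cube_data c); split.
- exact: classL_cube_data.
- by rewrite mass_cube_data// gtr_pMr// expR_lt1 oppr_lt0.
move=> /(gaussian_midpoint_concave n delta n1 d0) mid.
(* Chosen so that [delta + s0 ^+ 2 = r], the point where [kappa] exceeds [1 / 2]. *)
pose s0 := Num.sqrt (r - delta).
have s0E : s0 ^+ 2 = r - delta by rewrite sqr_sqrtr// ltW.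
pose P z := delta + z ^+ 2.
have P0 z : 0 < P z by rewrite ltr_wpDr ?sqr_ge0.
have dP (z : R) : is_derive z 1 P (2 * z).
  by apply: is_derive_eq; rewrite /GRing.scale/=; ring.
have dG (z : R) : is_derive z 1 (calF a F \o P) (derive1 (calF a F) (P z) * (2 * z)).
  exact: (@is_derive1_comp _ (calF a F) P z _ _
    (is_derive_calF a F ha hC2 _ (P0 z)) (dP z)).
have d1 := @is_derive1_comp _ (derive1 (calF a F)) P s0 _ _
  (is_derive_calF1 a F ha hC2 _ (P0 s0)) (dP s0).
have d2 : is_derive s0 1 (fun z : R => 2 * z) 2.
  by apply: is_derive_eq; rewrite /GRing.scale/=; ring.
have := second_derivative_le0 _ _ s0 _ dG (is_deriveM d1 d2) (mid s0).
have -> : P s0 = r by rewrite /P s0E; lra.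
rewrite /GRing.scale/= leNgt => /negP; apply.
have p0 := calF1_lt0 a F ha hC2 hF' _ r0.
move: kE; rewrite /kappa /P s0E subrKC.
set p := derive1 (calF a F) r in p0 *; set q := derive1 (derive1 _) r => kE.
have rq : r * q = - k * p by rewrite kE; field; rewrite lt_eqF.
(* Times [r], the second derivative at [s0] is [- (2 * p) * (2 * k * (r - delta) - r)], positive
   since [p < 0] and by the choice of [delta]. *)
rewrite -(pmulr_rgt0 _ r0).
have -> : r * (p * 2 + 2 * s0 * (q * (2 * s0))) =
    2 * p * r + 4 * s0 ^+ 2 * (r * q) by ring.
rewrite rq s0E.
have -> : 2 * p * r + 4 * (r - delta) * (- k * p) =
    - (2 * p) * (2 * k * (r - delta) - r) by ring.
by rewrite rd mulr_gt0//; [lra|nra].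
Qed.

End failure.

Theorem theorem1p3 (R : realType) (n : nat) (hn : (1 <= n)%N) (a : R)
    (ha : 0 < a) (F : R -> \bar R) (hF : admissible a F)
    (hC2 : C2_on a (fine \o F))
    (hF' : forall s, 0 < s < a -> 0 < derive1 (fine \o F) s) :
  ((forall r, 0 < r -> kappa a F r <= 1 / 2) ->
   (kappa_star a F < (1 / 2)%:E)%E ->
   forall phi : 'rV[R]_n -> R, classL phi -> mass phi < a ->
     eventually_F_concave a F (n%:R / 2) phi) /\
  ((exists2 r : R, 0 < r & 1 / 2 < kappa a F r) ->
   exists phi : 'rV[R]_n -> R,
     [/\ classL phi, mass phi < a &
         ~ eventually_F_concave a F (n%:R / 2) phi]).
Proof.
split; first by move=> kle kstar phi; exact: eventually_F_concave_of_kappa.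
exact: not_eventually_F_concave_of_kappa.
Qed.
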